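(* Let $A\in\mathbb{R}^{m\times n}$, $b\in\mathbb{R}^m$, $\alpha>0$, let $g:\mathbb{R}^m\to\mathbb{R}$ be a convex function such that $\mathbf{prox}_{\alpha g^*}$ is well defined, and let $M\in\mathbb{R}^{n\times n}$ be a symmetric matrix with $M\succeq \alpha A^TA$. Assume that the primal problem $\min_{x\in\mathbb{R}^n} g(Ax-b)$ has a solution, that the dual problem of maximizing $-g^*(u)-u^Tb$ over $u\in\mathbb{R}^m$ subject to $A^Tu=0$ has a solution, and that strong duality holds, i.e. the two optimal values are equal. Furthermore, assume that $g$ is $L$-Lipschitz continuous, i.e. $|g(y)-g(z)|\le L\|y-z\|$ for all $y,z\in\mathbb{R}^m$. Let $x^0\in\mathbb{R}^n$ and $u^0\in\mathbb{R}^m$ be arbitrary and, for $k=0,1,\dots$, define \[ x^{k+1}=x^k-M^{+}A^Tu^k,\qquad u^{k+1}=\mathbf{prox}_{\alpha g^*}\bigl(u^k+\alpha(A(2x^{k+1}-x^k)-b)\bigr). \] Then for every primal solution $x^\star$, every dual solution $u^\star$, and every $k=0,1,\dots$, \[ g(Ax^{k+1}-b)-g(Ax^\star-b)\le \frac{1}{\alpha\sqrt{k+1}}\Bigl(\|u^0-u^\star-\alpha A(x^0-x^\star)\|+\|u^\star\|+L+\|x^0-x^\star\|_{(\alpha M-\alpha^2A^TA)}\Bigr)^2 . \]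
   Context: $M^+$ denotes the Moore--Penrose pseudoinverse of $M$. For symmetric matrices $P,Q$, $P\succeq Q$ means that $P-Q$ is positive semidefinite. For a symmetric positive semidefinite matrix $P$, $\|x\|_P=(x^TPx)^{1/2}$ (a seminorm); $\|\cdot\|$ is the Euclidean norm. The conjugate of $g$ is $g^*(u)=\sup_{x\in\mathbb{R}^m}\{u^Tx-g(x)\}$. The proximal operator is $\mathbf{prox}_{\alpha h}(z)=\operatorname{argmin}_{x\in\mathbb{R}^m}\{\alpha h(x)+\tfrac12\|x-z\|^2\}$. The iteration in the claim is called near-circulant splitting (NCS). *)

(* Defs.v *)
From HB Require Import structures.
From mathcomp Require Export all_boot all_order all_algebra.
From mathcomp Require Export all_classical all_reals all_analysis.

#[export] Set Implicit Arguments.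
#[export] Unset Strict Implicit.
#[export] Unset Printing Implicit Defensive.

Import Order.TTheory GRing.Theory Num.Theory.
Import numFieldNormedType.Exports.
Local Open Scope classical_set_scope.
Local Open Scope ring_scope.

Section Matrices.
Context {R : realType}.

Definition dot (d : nat) (u v : 'cV[R]_d) : R := (u^T *m v) 0 0.

(* The norm that MathComp-Analysis puts on matrices is the sup norm, hence a
   separate Euclidean norm. *)
Definition enorm (d : nat) (x : 'cV[R]_d) : R := Num.sqrt (dot x x).

Definition seminorm (d : nat) (P : 'M[R]_d) (x : 'cV[R]_d) : R :=
  Num.sqrt (dot x (P *m x)).

Definition psdmx (d : nat) (P : 'M[R]_d) : Prop :=
  P \is symmetricmx /\ forall x : 'cV[R]_d, 0 <= dot x (P *m x).

(* [pinvmx] in mxalgebra is only a partial inverse, not the Moore--Penrose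
   pseudoinverse. *)
Definition is_moore_penrose (p q : nat)
    (B : 'M[R]_(p, q)) (X : 'M[R]_(q, p)) : Prop :=
  [/\ B *m X *m B = B, X *m B *m X = X,
      (B *m X)^T = B *m X & (X *m B)^T = X *m B].

Definition moore_penrose (p q : nat) (B : 'M[R]_(p, q)) : 'M[R]_(q, p) :=
  xget 0 [set X | is_moore_penrose B X].

End Matrices.

Section MoorePenroseTheory.
Context {R : realType}.

Lemma dot_eq0 (d : nat) (x : 'cV[R]_d) : dot x x = 0 -> x = 0.
Proof.
rewrite /dot !mxE => /eqP.
under eq_bigr do rewrite mxE -expr2.
rewrite psumr_eq0; last by move=> i _; exact: sqr_ge0.
move=> /allP x0; apply/matrixP => i j; rewrite ord1 mxE.
by have := x0 i (mem_index_enum _); rewrite /= sqrf_eq0 => /eqP.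
Qed.

Lemma gram_unitmx (p q : nat) (F : 'M[R]_(p, q)) :
  row_free F -> F *m F^T \in unitmx.
Proof.
move=> freeF; rewrite -row_free_unit -kermx_eq0.
apply/eqP/row_matrixP => i; rewrite row0.
have vFF : row i (kermx (F *m F^T)) *m (F *m F^T) = 0.
  by rewrite -row_mul mulmx_ker row0.
set v := row i _ in vFF *.
suff vF : v *m F = 0 by apply: (row_free_inj freeF); rewrite mul0mx.
apply: trmx_inj; rewrite trmx0; apply: dot_eq0.
by rewrite /dot trmxK trmx_mul mulmxA -(mulmxA v) vFF mul0mx mxE.
Qed.

Lemma is_moore_penrose_uniq (p q : nat) (B : 'M[R]_(p, q))
    (X Y : 'M[R]_(q, p)) :
  is_moore_penrose B X -> is_moore_penrose B Y -> X = Y.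
Proof.
move=> [BXB XBX sBX sXB] [BYB YBY sBY sYB].
have BXY : B *m X = B *m Y.
  rewrite -sBX -{1}BYB -(mulmxA (B *m Y)) trmx_mul sBX sBY.
  by rewrite mulmxA BXB.
have XYB : X *m B = Y *m B.
  rewrite -sXB -{1}BYB -(mulmxA B) mulmxA trmx_mul sXB sYB.
  by rewrite -mulmxA (mulmxA B) BXB.
by rewrite -XBX XYB -mulmxA BXY mulmxA YBY.
Qed.

Lemma is_moore_penrose_exists (p q : nat) (B : 'M[R]_(p, q)) :
  exists X, is_moore_penrose B X.
Proof.
pose C := col_base B; pose F := row_base B.
have uF : F *m F^T \in unitmx by apply/gram_unitmx/row_base_free.
have uC : C^T *m C \in unitmx.
  rewrite -{2}(trmxK C); apply: gram_unitmx.
  by rewrite /row_free mxrank_tr; exact: col_base_full.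
have BE : C *m F = B by exact: mulmx_base.
clearbody C F.
pose Fp := F^T *m invmx (F *m F^T); pose Cp := invmx (C^T *m C) *m C^T.
have FFp : F *m Fp = 1%:M by rewrite mulmxA mulmxV.
have CpC : Cp *m C = 1%:M by rewrite -mulmxA mulVmx.
have BX : B *m (Fp *m Cp) = C *m Cp.
  by rewrite -{1}BE -mulmxA (mulmxA F) FFp mul1mx.
have XB : Fp *m Cp *m B = Fp *m F.
  by rewrite -[X in _ *m X = _]BE -mulmxA (mulmxA Cp) CpC mul1mx.
exists (Fp *m Cp); split.
- by rewrite BX -[X in _ *m X = _]BE -mulmxA (mulmxA Cp) CpC mul1mx BE.
- by rewrite XB -mulmxA (mulmxA F) FFp mul1mx.
- by rewrite BX /Cp !trmx_mul trmxK trmx_inv trmx_mul trmxK mulmxA.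
- by rewrite XB /Fp !trmx_mul trmxK trmx_inv trmx_mul trmxK mulmxA.
Qed.

Lemma moore_penroseP (p q : nat) (B : 'M[R]_(p, q)) :
  is_moore_penrose B (moore_penrose B).
Proof. exact: (xgetPex 0 (is_moore_penrose_exists B)). Qed.

End MoorePenroseTheory.

Section ConvexAnalysis.
Context {R : realType}.
Local Open Scope ereal_scope.

Definition argmin {T : Type} (D : set T) (f : T -> \bar R) : set T :=
  [set x | D x /\ forall y, D y -> f x <= f y].

Definition argmax {T : Type} (D : set T) (f : T -> \bar R) : set T :=
  [set x | D x /\ forall y, D y -> f y <= f x].

Definition conjugate (d : nat) (g : 'cV[R]_d -> R) (u : 'cV[R]_d) : \bar R :=
  ereal_sup (range (fun x : 'cV[R]_d => (dot u x - g x)%:E)).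

Definition prox_set (d : nat) (alpha : R) (h : 'cV[R]_d -> \bar R)
    (z : 'cV[R]_d) : set 'cV[R]_d :=
  argmin setT (fun x => alpha%:E * h x + (2^-1 * enorm (x - z) ^+ 2)%:E).

Definition prox_well_defined (d : nat) (alpha : R)
    (h : 'cV[R]_d -> \bar R) : Prop :=
  forall z, exists! x, prox_set alpha h z x.

Definition prox (d : nat) (alpha : R) (h : 'cV[R]_d -> \bar R)
    (z : 'cV[R]_d) : 'cV[R]_d :=
  xget 0%R (prox_set alpha h z).

Definition primal_obj (m n : nat) (A : 'M[R]_(m, n)) (b : 'cV[R]_m)
    (g : 'cV[R]_m -> R) (x : 'cV[R]_n) : \bar R := (g (A *m x - b))%:E.

Definition dual_obj (m : nat) (b : 'cV[R]_m) (g : 'cV[R]_m -> R)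
    (u : 'cV[R]_m) : \bar R := - conjugate g u - (dot u b)%:E.

Definition dual_feasible (m n : nat) (A : 'M[R]_(m, n)) : set 'cV[R]_m :=
  [set u | A^T *m u = 0%R].

Definition primal_solution (m n : nat) (A : 'M[R]_(m, n)) (b : 'cV[R]_m)
    (g : 'cV[R]_m -> R) : set 'cV[R]_n :=
  argmin setT (primal_obj A b g).

Definition dual_solution (m n : nat) (A : 'M[R]_(m, n)) (b : 'cV[R]_m)
    (g : 'cV[R]_m -> R) : set 'cV[R]_m :=
  argmax (dual_feasible A) (dual_obj b g).

Definition strong_duality (m n : nat) (A : 'M[R]_(m, n)) (b : 'cV[R]_m)
    (g : 'cV[R]_m -> R) : Prop :=
  ereal_inf (range (primal_obj A b g)) =
  ereal_sup (dual_obj b g @` dual_feasible A).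

End ConvexAnalysis.

(* Main.v *)
Require Import Defs.
From mathcomp Require Import all_boot all_order all_algebra.
From mathcomp Require Import all_classical all_reals all_analysis.
From mathcomp Require Import ring lra.
Import Order.TTheory GRing.Theory Num.Theory.
Import numFieldNormedType.Exports.
Local Open Scope ring_scope.

(** Near-circulant splitting is the proximal point algorithm in a degenerate
    metric.  Put z = (x, u) and let
<<
            [  alpha M    - alpha A^T ]
        P = [                         ]
            [ - alpha A        1      ]
>>
    Completing the square gives
    |z|_P^2 = |u - alpha A x|^2 + |x|_(alpha M - alpha^2 A^T A)^2, so that P is
    positive semidefinite exactly because M dominates alpha A^T A, and the
    initial distance |z_0 - z*|_P is at most the sum of the two norms of
    x_0 - x*, u_0 - u* that appear in the bound ([ncs_metric_quad]).

    Let y_k = (u_k + alpha (A (2 x_{k+1} - x_k) - b) - u_{k+1}) / alpha.  The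
    dual step says that u_{k+1} is a subgradient of g at y_k
    ([prox_conjugate_subgradient]), and the primal step says
    M (x_k - x_{k+1}) = A^T u_k, because the range of A^T lies in the range
    of M ([moore_penrose_trmx]).  Together they read P (z_k - z_{k+1}) =
    alpha T_k, where T_k = (A^T u_{k+1}, y_k - (A x_{k+1} - b)) is a value at
    z_{k+1} of the monotone saddle operator ([ncs_step_metric],
    [dot_saddle_field]).  By strong duality (x*, u* ) is a zero of that
    operator ([dual_solution_subgradient]).  Fejer monotonicity and the
    monotone decrease of the steps d_k = z_k - z_{k+1} then give
    sqrt(k+1) |d_k|_P <= D and |z_{k+1} - z*|_P <= D, with D = |z_0 - z*|_P
    ([proximal_point_rate], [proximal_point_dist]).

    It remains to bound the primal gap by |d_k|_P.  Let
    w = (u_k - u_{k+1}) - alpha A (x_k - x_{k+1}); then |w| <= |d_k|_P and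
    y_k - (A x_{k+1} - b) = w / alpha.  The Lipschitz bound yields
    g (A x_{k+1} - b) - g (y_k) <= L |w| / alpha.  With y* = A x* - b, the
    subgradient inequality at y_k yields
    alpha (g (y_k) - g (y* )) <= alpha <u_{k+1}, y_k - y*>
       = <z_{k+1} - z*, P d_k> + <u*, w>,
    and Cauchy-Schwarz bounds the right-hand side by (D + |u*|) |d_k|_P.
    Hence alpha times the gap is at most (D / sqrt(k+1)) (D + |u*| + L). *)

(** * Inner products and positive semidefinite forms *)

Section Dot.
Context {R : realType}.

Lemma dotDl d (x y z : 'cV[R]_d) : dot (x + y) z = dot x z + dot y z.
Proof. by rewrite /dot linearD mulmxDl mxE. Qed.

Lemma dotZl d a (x y : 'cV[R]_d) : dot (a *: x) y = a * dot x y.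
Proof. by rewrite /dot linearZ /= -scalemxAl mxE. Qed.

Lemma dotC d (x y : 'cV[R]_d) : dot x y = dot y x.
Proof. by rewrite /dot -[in RHS](trmxK x) -trmx_mul [RHS]mxE. Qed.

Lemma dotDr d (x y z : 'cV[R]_d) : dot x (y + z) = dot x y + dot x z.
Proof. by rewrite ![dot x _]dotC dotDl. Qed.

Lemma dotZr d a (x y : 'cV[R]_d) : dot x (a *: y) = a * dot x y.
Proof. by rewrite dotC dotZl dotC. Qed.

Lemma dotNl d (x y : 'cV[R]_d) : dot (- x) y = - dot x y.
Proof. by rewrite -scaleN1r dotZl mulN1r. Qed.

Lemma dotNr d (x y : 'cV[R]_d) : dot x (- y) = - dot x y.
Proof. by rewrite dotC dotNl dotC. Qed.

Definition dotE := (dotDl, dotDr, dotZl, dotZr, dotNl, dotNr).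

Lemma dot_mulmx p q (B : 'M[R]_(p, q)) x y : dot x (B *m y) = dot (B^T *m x) y.
Proof. by rewrite /dot trmx_mul trmxK mulmxA. Qed.

Lemma dot_col_mx p q (x y : 'cV[R]_p) (u v : 'cV[R]_q) :
  dot (col_mx x u) (col_mx y v) = dot x y + dot u v.
Proof. by rewrite /dot tr_col_mx mul_row_col mxE. Qed.

Lemma dot_ge0 d (x : 'cV[R]_d) : 0 <= dot x x.
Proof. by rewrite /dot mxE sumr_ge0 // => i _; rewrite mxE -expr2 sqr_ge0. Qed.

Lemma symmetricmx_tr d (P : 'M[R]_d) : P \is symmetricmx -> P^T = P.
Proof. by move=> /is_hermitianmxP; rewrite expr0 scale1r map_mx_id. Qed.

Lemma symmetricmx_dotC d (P : 'M[R]_d) x y :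
  P \is symmetricmx -> dot x (P *m y) = dot y (P *m x).
Proof. by move=> /symmetricmx_tr PT; rewrite dot_mulmx PT dotC. Qed.

Lemma psdmx1 d : psdmx (1%:M : 'M[R]_d).
Proof.
split; last by move=> x; rewrite mul1mx dot_ge0.
by apply/is_hermitianmxP; rewrite expr0 scale1r map_mx_id // trmx1.
Qed.

Lemma enormE d (x : 'cV[R]_d) : enorm x = seminorm 1%:M x.
Proof. by rewrite /seminorm mul1mx. Qed.

Lemma enorm_ge0 d (x : 'cV[R]_d) : 0 <= enorm x.
Proof. exact: sqrtr_ge0. Qed.

Lemma seminorm_ge0 d (P : 'M[R]_d) x : 0 <= seminorm P x.
Proof. exact: sqrtr_ge0. Qed.

Lemma sqr_seminorm d (P : 'M[R]_d) x :
  psdmx P -> seminorm P x ^+ 2 = dot x (P *m x).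
Proof. by case=> _ P0; rewrite sqr_sqrtr. Qed.

Lemma sqr_enorm d (x : 'cV[R]_d) : enorm x ^+ 2 = dot x x.
Proof. by rewrite sqr_sqrtr // dot_ge0. Qed.

Lemma enormZ d a (x : 'cV[R]_d) : enorm (a *: x) = `|a| * enorm x.
Proof.
by rewrite /enorm dotZl dotZr mulrA -expr2 sqrtrM ?sqr_ge0 // sqrtr_sqr.
Qed.

Lemma enorm_distC d (x y : 'cV[R]_d) : enorm (x - y) = enorm (y - x).
Proof. by rewrite -opprB /enorm dotNl dotNr opprK. Qed.

Lemma entry_le_enorm d (v : 'cV[R]_d) i : `|v i 0| <= enorm v.
Proof.
rewrite -sqrtr_sqr ler_wsqrtr // /dot mxE (bigD1 i) //= mxE -expr2 lerDl.
by rewrite sumr_ge0 // => j _; rewrite mxE -expr2 sqr_ge0.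
Qed.

Lemma sqr_seminormB d (P : 'M[R]_d) x y : psdmx P ->
  seminorm P (x - y) ^+ 2 =
  seminorm P x ^+ 2 - 2 * dot x (P *m y) + seminorm P y ^+ 2.
Proof.
move=> Ppsd; rewrite !sqr_seminorm // mulmxBr !dotE.
by rewrite (symmetricmx_dotC y x Ppsd.1); ring.
Qed.

Lemma seminorm_distC d (P : 'M[R]_d) x y :
  seminorm P (x - y) = seminorm P (y - x).
Proof. by rewrite -opprB /seminorm mulmxN dotNl dotNr opprK. Qed.

Lemma quadratic_ge0_discr (a b c : R) : 0 <= a ->
  (forall t, 0 <= a * t ^+ 2 + 2 * b * t + c) -> b ^+ 2 <= a * c.
Proof.
rewrite le_eqVlt => /predU1P[<-|a_gt0] q_ge0; last first.
  (* - b / a is the vertex of the parabola *)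
  have /(mulr_ge0 (ltW a_gt0)) := q_ge0 (- b / a).
  rewrite -[in X in _ -> X]subr_ge0; congr (_ <= _); field.
  exact: lt0r_neq0.
have [->|b_neq0] := eqVneq b 0; first by rewrite expr0n /= mul0r.
(* a nonconstant affine function takes the value - 1 *)
have := q_ge0 (- (c + 1) / (2 * b)).
have -> : 0 * (- (c + 1) / (2 * b)) ^+ 2 + 2 * b * (- (c + 1) / (2 * b)) + c
    = - 1 by field.
by rewrite ler0N1.
Qed.

(** Cauchy-Schwarz for a form that may be degenerate: the discriminant of
    t |-> |t x + y|_P^2 is nonpositive, also when |x|_P = 0. *)
Lemma dot_le_seminorm d (P : 'M[R]_d) x y :
  psdmx P -> dot x (P *m y) <= seminorm P x * seminorm P y.
Proof.
move=> Ppsd; have [Psym P0] := Ppsd.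
have [Pxy|Pxy] := lerP (dot x (P *m y)) 0.
  by apply: le_trans Pxy _; rewrite mulr_ge0 ?seminorm_ge0.
rewrite -ler_sqr ?nnegrE ?mulr_ge0 ?seminorm_ge0 ?(ltW Pxy) //.
rewrite exprMn !sqr_seminorm //.
apply: quadratic_ge0_discr => [|t]; first exact: P0.
have := P0 (t *: x + y).
rewrite mulmxDr -scalemxAr !dotE (symmetricmx_dotC y) //.
by congr (_ <= _); ring.
Qed.

Lemma dot_le_enorm d (x y : 'cV[R]_d) : dot x y <= enorm x * enorm y.
Proof. by rewrite !enormE -{1}[y]mul1mx dot_le_seminorm //; exact: psdmx1. Qed.

End Dot.

(** * Subgradients and the proximal operator of the conjugate *)

Section Subgradient.
Context {R : realType}.

Definition is_subgradient d (g : 'cV[R]_d -> R) (y p : 'cV[R]_d) : Prop :=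
  forall v, g y + dot p (v - y) <= g v.

Lemma subgradient_monotone d (g : 'cV[R]_d -> R) y p y' p' :
  is_subgradient g y p -> is_subgradient g y' p' ->
  0 <= dot (p - p') (y - y').
Proof. by move=> /(_ y') + /(_ y); rewrite !dotE; lra. Qed.

Lemma conjugate_subgradient d (g : 'cV[R]_d -> R) y p :
  is_subgradient g y p -> conjugate g p = (dot p y - g y)%:E.
Proof.
move=> sub; apply/eqP; rewrite eq_le; apply/andP; split.
  apply: ge_ereal_sup => _ [v _ <-]; rewrite lee_fin.
  by have := sub v; rewrite !dotE; lra.
by apply: ereal_sup_ubound; exists y.
Qed.

Lemma le_fenchel d (g : 'cV[R]_d -> R) y p :
  ((dot p y - g y)%R%:E <= conjugate g p)%E.
Proof. by apply: ereal_sup_ubound; exists y. Qed.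

Lemma ge0_of_affine_ge0 (a c : R) :
  (forall t, 0 < t <= 1 -> 0 <= a + t * c) -> 0 <= a.
Proof.
move=> h; rewrite leNgt; apply/negP => a_lt0.
have c_gt0 : 0 < c by have := h 1; lra.
(* at this t the term t c makes up for at most half of the deficit a *)
pose t := Num.min 1 (- a / (2 * c)).
have t_gt0 : 0 < t by rewrite lt_min ltr01 divr_gt0 // ?oppr_gt0 // mulr_gt0.
have := h t; rewrite t_gt0 ge_min lexx /= => /(_ isT).
have : t * c <= (- a / (2 * c)) * c.
  by rewrite ler_pM2r // ge_min lexx orbT.
have -> : - a / (2 * c) * c = - a / 2 by field; exact: lt0r_neq0.
lra.
Qed.

Lemma convex_functionE d (g : 'cV[R]_d -> R) (t : R) x y :
  convex_function setT g -> 0 <= t <= 1 ->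
  g (t *: x + (1 - t) *: y) <= t * g x + (1 - t) * g y.
Proof.
move=> cvx /andP[t_ge0 t_le1].
exact: (cvx (Itv01 t_ge0 t_le1) x y (in_setT _) (in_setT _)).
Qed.

(** First-order optimality: moving from the minimiser y towards v by a
    fraction t changes the objective by at most
    t (g v - g y - <a (c - y), v - y>) + O(t^2), so the coefficient of t is
    nonnegative. *)
Lemma quadratic_min_subgradient d (g : 'cV[R]_d -> R) (a : R) c y :
  convex_function setT g ->
  (forall v, g y + a / 2 * enorm (y - c) ^+ 2 <=
             g v + a / 2 * enorm (v - c) ^+ 2) ->
  is_subgradient g y (a *: (c - y)).
Proof.
move=> cvx ymin v; rewrite -subr_ge0.
apply: (@ge0_of_affine_ge0 _ (a / 2 * dot (v - y) (v - y))) => t /andP[t0 t1].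
have := ymin (t *: v + (1 - t) *: y).
have := convex_functionE v y cvx (_ : 0 <= t <= 1).
rewrite (ltW t0) t1 => /(_ isT) gt ymin'.
rewrite -(pmulr_rge0 _ t0).
have := le_trans ymin' (lerD gt (lexx _)).
have -> : t *: v + (1 - t) *: y - c = (y - c) + t *: (v - y).
  by apply/colP => i; rewrite !mxE; ring.
rewrite !sqr_enorm -subr_ge0 !dotE (dotC v y) (dotC c y) (dotC c v).
by congr (_ <= _); field.
Qed.

(** The two continuity lemmas are phrased on row vectors because closed boxes
    are known to be compact there ([rV_compact]). *)
Lemma enorm_trmx_continuous d (c : 'cV[R]_d) :
  continuous (fun w : 'rV[R]_d => enorm (w^T - c)).
Proof.
suff dot_cont : continuous (fun w : 'rV[R]_d => dot (w^T - c) (w^T - c)).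
  move=> w; apply: (@continuous_comp _ _ _
    (fun w : 'rV[R]_d => dot (w^T - c) (w^T - c)) Num.sqrt).
    exact: dot_cont.
  exact: sqrt_continuous.
have -> : (fun w : 'rV[R]_d => dot (w^T - c) (w^T - c)) =
    (fun w => \sum_i (w 0 i - c i 0) * (w 0 i - c i 0)).
  by apply/funext => v; rewrite /dot mxE; apply: eq_bigr => i _; rewrite !mxE.
apply: (continuous_big add_continuous) => i _ w.
have entry_cont : {for w, continuous (fun w : 'rV[R]_d => w 0 i - c i 0)}.
  by apply: continuousB; [exact: coord_continuous|exact: cst_continuous].
exact: (continuousM entry_cont entry_cont).
Qed.

Lemma lipschitz_trmx_continuous d (g : 'cV[R]_d -> R) L :
  (forall y z, `|g y - g z| <= L * enorm (y - z)) ->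
  continuous (fun w : 'rV[R]_d => g w^T).
Proof.
move=> glip w.
suff : ((fun v : 'rV[R]_d => g v^T) @ w --> g w^T)%classic by [].
apply/(@cvgrPdist_lt _ _ _ (nbhs w)) => e e_gt0.
have bound_cont :
    {for w, continuous (fun v : 'rV[R]_d => L * enorm (v^T - w^T))}.
  exact: (continuousM (@cst_continuous _ _ L _)
                      (@enorm_trmx_continuous _ w^T w)).
have bound0 : L * enorm (w^T - w^T) < e.
  by rewrite subrr /enorm /dot mulmx0 mxE sqrtr0 mulr0.
near=> v; rewrite distrC; apply: le_lt_trans (glip _ _) _; near: v.
exact: (cvgr_lt _ bound_cont).
Unshelve. all: by end_near.
Qed.

Lemma quadratic_min_exists d (g : 'cV[R]_d -> R) L (a : R) c :
  0 < a ->
  (forall y z, `|g y - g z| <= L * enorm (y - z)) ->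
  exists y, forall v, g y + a / 2 * enorm (y - c) ^+ 2 <=
                      g v + a / 2 * enorm (v - c) ^+ 2.
Proof.
move=> a_gt0 glip.
pose f (w : 'rV[R]_d) := g w^T + a / 2 * enorm (w^T - c) ^+ 2.
(* at a distance e >= 2 |L| / a from c, the gain a e^2 / 2 of the quadratic
   term outweighs the possible decrease |L| e of g *)
pose r := 2 * `|L| / a.
have r_ge0 : 0 <= r by rewrite divr_ge0 ?(ltW a_gt0) // mulr_ge0.
pose box := [set w : 'rV[R]_d |
  forall i, `[c i 0 - r, c i 0 + r]%classic (w 0 i)]%classic.
have c_box : box c^T.
  by move=> i; rewrite /= in_itv /= mxE gerBl lerDl r_ge0.
have box_compact : compact box.
  apply: (@rV_compact _ _ (fun i => `[c i 0 - r, c i 0 + r]%classic)) => i.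
  exact: segment_compact.
have f_cont : continuous f.
  move=> w; have e_cont := @enorm_trmx_continuous _ c w.
  apply: (continuousD (@lipschitz_trmx_continuous _ _ _ glip w)).
  exact: (continuousM (@cst_continuous _ _ (a / 2) _)
                      (continuousM e_cont e_cont)).
have [||w _ wmin] := @EVT_min_rV _ _ f box _ box_compact.
- by exists c^T.
- exact: continuous_subspaceT.
exists w^T => v; have [v_box|v_box] := pselect (box v^T).
  by have := wmin v^T (mem_set v_box); rewrite /f trmxK.
apply: le_trans (wmin c^T (mem_set c_box)) _.
rewrite /f trmxK subrr sqr_enorm /dot mulmx0 mxE mulr0 addr0.
have [i] : exists i, ~ `[c i 0 - r, c i 0 + r]%classic (v^T 0 i).
  exact/existsNP.
rewrite /= in_itv /= mxE -ler_distlC => /negP; rewrite -ltNge distrC => r_lt.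
have r_enorm : r < enorm (v - c).
  apply: lt_le_trans r_lt _.
  by have := entry_le_enorm (v - c) i; rewrite !mxE.
have L_le_quad : `|L| * enorm (v - c) <= a / 2 * enorm (v - c) ^+ 2.
  rewrite expr2 mulrA ler_wpM2r ?enorm_ge0 //.
  have -> : `|L| = a / 2 * r by rewrite /r; field; exact: lt0r_neq0.
  by rewrite ler_pM2l ?divr_gt0 // ltW.
have : L * enorm (v - c) <= `|L| * enorm (v - c).
  by rewrite ler_wpM2r ?enorm_ge0 // ler_norm.
have := glip v c; rewrite ler_norml => /andP[]; lra.
Qed.

(** Moreau's decomposition.  The minimiser y of
    g + (alpha/2) |. - z/alpha|^2 makes p = z - alpha y a subgradient of g
    at y; the Fenchel inequality at y then shows that p minimises
    alpha g^* + |. - z|^2 / 2, so p is the proximal point.  Going through y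
    yields a subgradient of g itself without any biconjugation theorem. *)
Lemma prox_conjugate_subgradient d (g : 'cV[R]_d -> R) L (alpha : R) z :
  0 < alpha -> convex_function setT g ->
  (forall y z, `|g y - g z| <= L * enorm (y - z)) ->
  prox_well_defined alpha (conjugate g) ->
  is_subgradient g (alpha^-1 *: (z - prox alpha (conjugate g) z))
    (prox alpha (conjugate g) z).
Proof.
move=> alpha_gt0 cvx glip wd.
have alpha_neq0 := lt0r_neq0 alpha_gt0.
have [y ymin] := quadratic_min_exists (alpha^-1 *: z) alpha_gt0 glip.
set p := alpha *: (alpha^-1 *: z - y).
have sub : is_subgradient g y p by exact: quadratic_min_subgradient ymin.
have yE : y = alpha^-1 *: (z - p).
  by apply/colP => i; rewrite /p !mxE; field.
suff -> : prox alpha (conjugate g) z = p by rewrite -yE.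
have prox_p : prox_set alpha (conjugate g) z p.
  split=> // v _; rewrite (conjugate_subgradient sub).
  have := le_fenchel g y v.
  case: (conjugate g v) => [s| _|]; last 2 first.
  - by rewrite gt0_muley ?lte_fin // addye // leey.
  - by rewrite leeNy_eq.
  rewrite !lee_fin => le_s.
  have -> : v - z = (p - z) + (v - p) by apply/colP => i; rewrite !mxE; ring.
  have pz : p - z = - (alpha *: y).
    by apply/colP => i; rewrite /p !mxE; field.
  rewrite !sqr_enorm pz.
  have := dot_ge0 (v - p); set e := v - p => e_ge0.
  have vE : dot v y = dot e y + dot p y by rewrite /e !dotE; ring.
  have := ler_wpM2l (ltW alpha_gt0) le_s.
  rewrite vE; clearbody e; clearbody p.
  rewrite !dotE (dotC y e); lra.
have [q [_ q_uniq]] := wd z.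
have q_p := q_uniq _ prox_p.
by rewrite /prox -(q_uniq _ (xgetPex 0 (ex_intro _ p prox_p))) -q_p.
Qed.

Lemma lipschitz_neg_const d (g : 'cV[R]_d -> R) L y z :
  (forall y z, `|g y - g z| <= L * enorm (y - z)) -> L < 0 -> g y = g z.
Proof.
move=> glip L_lt0; apply/eqP; rewrite -subr_eq0 -normr_le0.
by apply: le_trans (glip y z) _; rewrite nmulr_rle0 ?enorm_ge0.
Qed.

End Subgradient.

(** * Optimality conditions and the pseudoinverse *)

Section Optimality.
Context {R : realType}.

Lemma argmin_ereal_inf (T : Type) (f : T -> \bar R) (D : set T) x :
  argmin D f x -> ereal_inf (f @` D)%classic = f x.
Proof.
move=> [Dx xmin]; apply/eqP; rewrite eq_le ereal_inf_lbound /=; last first.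
  by exists x.
by apply: le_ereal_inf_tmp => _ [y Dy <-]; exact: xmin.
Qed.

Lemma argmax_ereal_sup (T : Type) (f : T -> \bar R) (D : set T) x :
  argmax D f x -> ereal_sup (f @` D)%classic = f x.
Proof.
move=> [Dx xmax]; apply/eqP; rewrite eq_le ereal_sup_ubound ?andbT /=.
  by apply: ge_ereal_sup => _ [y Dy <-]; exact: xmax.
by exists x.
Qed.

(** Strong duality gives g (y* ) = - g^* (u* ) - <u*, b> with y* = A x* - b,
    and <u*, b> = - <u*, y*> by feasibility: this is equality in the Fenchel
    inequality for the pair (y*, u* ). *)
Lemma dual_solution_subgradient m n (A : 'M[R]_(m, n)) b g xs us :
  strong_duality A b g -> primal_solution A b g xs -> dual_solution A b g us ->
  is_subgradient g (A *m xs - b) us.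
Proof.
rewrite /strong_duality => + xsol usol; have [/= feas _] := usol.
rewrite (argmin_ereal_inf xsol) (argmax_ereal_sup usol).
rewrite /primal_obj /dual_obj => gapE v.
have := le_fenchel g v us.
have us_ys : dot us (A *m xs - b) = - dot us b.
  by rewrite dotDr dot_mulmx feas dotNr /dot trmx0 mul0mx mxE add0r.
case: (conjugate g us) gapE => [s| |] //= [] -> .
rewrite lee_fin dotDr dotNr us_ys; lra.
Qed.

(** With W = 1 - M M^+, the projector on the kernel of M, the hypothesis
    evaluated at W v reads 0 <= - a |A W v|^2; hence A W = 0, that is,
    the range of A^T lies in the range of M. *)
Lemma moore_penrose_trmx n m (M : 'M[R]_n) (A : 'M[R]_(m, n)) (a : R) :
  0 < a -> M \is symmetricmx -> psdmx (M - a *: (A^T *m A)) ->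
  M *m moore_penrose M *m A^T = A^T.
Proof.
move=> a_gt0 /symmetricmx_tr MT [_ psd].
have [MXM _ MXT _] := moore_penroseP M.
set X := moore_penrose M in MXM MXT *; pose W := 1%:M - M *m X.
have MW : M *m W = 0.
  apply: trmx_inj; rewrite trmx_mul MT trmx0 linearB /= trmx1 MXT.
  by rewrite mulmxBl mul1mx MXM subrr.
have AW : A *m W = 0.
  suff AWv (v : 'cV_n) : A *m (W *m v) = 0.
    apply/matrixP => i j; have /matrixP /(_ i 0) := AWv (delta_mx j 0).
    by rewrite mulmxA -colE mxE => ->; rewrite !mxE.
  apply: dot_eq0; apply/eqP; rewrite eq_le dot_ge0 andbT.
  have : M *m (W *m v) = 0 by rewrite mulmxA MW mul0mx.
  have := psd (W *m v); move: (W *m v) => w + Mw0.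
  rewrite mulmxBl Mw0 add0r -scalemxAl dotNr dotZr -mulmxA.
  by rewrite (dot_mulmx A^T) trmxK oppr_ge0 pmulr_rle0.
have : W *m A^T = 0.
  apply: trmx_inj; rewrite trmx_mul trmxK trmx0 /W linearB /= trmx1 MXT.
  exact: AW.
by rewrite mulmxBl mul1mx => /eqP; rewrite subr_eq0 => /eqP.
Qed.

End Optimality.

(** * The proximal point algorithm in a degenerate metric *)

(** [F k] stands for a value at [z k.+1] of a monotone operator for which [zs]
    is a zero.  Only the inequalities between values along the orbit matter,
    so no operator appears. *)
Section ProximalPoint.
Context {R : realType} {d : nat} (P : 'M[R]_d) (Ppsd : psdmx P).
Context (z F : nat -> 'cV[R]_d) (zs : 'cV[R]_d).
Context (step : forall k, P *m (z k - z k.+1) = F k).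
Context (F_monotone : forall j k, 0 <= dot (z j.+1 - z k.+1) (F j - F k)).
Context (zs_zero : forall k, 0 <= dot (z k.+1 - zs) (F k)).

Lemma proximal_point_fejer k :
  seminorm P (z k.+1 - zs) ^+ 2 + seminorm P (z k - z k.+1) ^+ 2 <=
  seminorm P (z k - zs) ^+ 2.
Proof.
have -> : z k - zs = (z k.+1 - zs) - (z k.+1 - z k).
  by apply/colP => i; rewrite !mxE; ring.
rewrite [leRHS]sqr_seminormB // (seminorm_distC P (z k.+1) (z k)).
rewrite -[z k.+1 - z k]opprB mulmxN dotNr step.
have := zs_zero k; lra.
Qed.

(** If p and q are consecutive steps, monotonicity says <q, p - q>_P >= 0, so
    that |p|_P^2 = |q|_P^2 + 2 <q, p - q>_P + |p - q|_P^2 >= |q|_P^2. *)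
Lemma proximal_point_residual k :
  seminorm P (z k.+1 - z k.+2) ^+ 2 <= seminorm P (z k - z k.+1) ^+ 2.
Proof.
have := F_monotone k k.+1; rewrite -!step -mulmxBr.
move: (z k - z k.+1) (z k.+1 - z k.+2) => p q.
have := sqr_ge0 (seminorm P (p - q)).
rewrite sqr_seminormB // mulmxBr !dotE (symmetricmx_dotC q p Ppsd.1).
rewrite -(sqr_seminorm q) //; lra.
Qed.

Lemma proximal_point_dist k :
  seminorm P (z k - zs) <= seminorm P (z 0%N - zs).
Proof.
elim: k => // k; apply: le_trans.
rewrite -ler_sqr ?nnegrE ?seminorm_ge0 //.
have := proximal_point_fejer k.
by have := sqr_ge0 (seminorm P (z k - z k.+1)); lra.
Qed.

(** The squared steps decrease, and by the Fejer inequality the first k + 1 of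
    them sum to at most the squared initial distance. *)
Lemma proximal_point_rate k :
  k.+1%:R * seminorm P (z k - z k.+1) ^+ 2 <= seminorm P (z 0%N - zs) ^+ 2.
Proof.
suff : k.+1%:R * seminorm P (z k - z k.+1) ^+ 2 + seminorm P (z k.+1 - zs) ^+ 2
    <= seminorm P (z 0%N - zs) ^+ 2.
  by have := sqr_ge0 (seminorm P (z k.+1 - zs)); lra.
elim: k => [|k IH].
  by have := proximal_point_fejer 0; rewrite mul1r addrC.
have := proximal_point_fejer k.+1.
have := ler_wpM2l (ler0n R k.+1) (proximal_point_residual k).
rewrite -[k.+2%:R]natr1 mulrDl mul1r; lra.
Qed.

End ProximalPoint.

(** * Near-circulant splitting as a proximal point algorithm *)

Section NearCirculant.
Context {R : realType} {m n : nat} (A : 'M[R]_(m, n)) (alpha : R).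

Definition ncs_metric (M : 'M[R]_n) : 'M[R]_(n + m) :=
  block_mx (alpha *: M) (- (alpha *: A^T)) (- (alpha *: A)) 1%:M.

Lemma ncs_metric_quad M (x : 'cV[R]_n) (u : 'cV[R]_m) :
  dot (col_mx x u) (ncs_metric M *m col_mx x u) =
  enorm (u - alpha *: (A *m x)) ^+ 2 +
  dot x ((alpha *: M - alpha ^+ 2 *: (A^T *m A)) *m x).
Proof.
rewrite mul_block_col dot_col_mx mul1mx !mulNmx mulmxBl -!scalemxAl.
rewrite sqr_enorm -mulmxA !dotE !(dot_mulmx A^T) trmxK.
by rewrite (dotC u (A *m x)); ring.
Qed.

Lemma ncs_gram_ge0 (M : 'M[R]_n) x :
  0 < alpha -> psdmx (M - alpha *: (A^T *m A)) ->
  0 <= dot x ((alpha *: M - alpha ^+ 2 *: (A^T *m A)) *m x).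
Proof.
move=> alpha_gt0 [_ psd].
by rewrite expr2 -scalerA -scalerBr -scalemxAl dotZr pmulr_rge0.
Qed.

Lemma ncs_metric_psd M : 0 < alpha -> M \is symmetricmx ->
  psdmx (M - alpha *: (A^T *m A)) -> psdmx (ncs_metric M).
Proof.
move=> alpha_gt0 /symmetricmx_tr MT psd; split.
  apply/is_hermitianmxP; rewrite expr0 scale1r map_mx_id //.
  by rewrite /ncs_metric tr_block_mx !linearN /= !linearZ /= trmxK trmx1 MT.
move=> z; rewrite -[z]vsubmxK ncs_metric_quad addr_ge0 ?sqr_ge0 //.
exact: ncs_gram_ge0.
Qed.

(** The saddle operator of (x, u) |-> <u, A x - b> - g^* u is set-valued;
    [y] selects one of its values at [(x, u)] whenever [u] is a subgradient of
    [g] at [y]. *)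
Definition saddle_field (b : 'cV[R]_m) (x : 'cV[R]_n) (u y : 'cV[R]_m) :=
  col_mx (A^T *m u) (y - (A *m x - b)).

(** The coupling terms in A form a skew-symmetric operator and cancel. *)
Lemma dot_saddle_field b x u y x' u' y' :
  dot (col_mx x u - col_mx x' u')
      (saddle_field b x u y - saddle_field b x' u' y') =
  dot (u - u') (y - y').
Proof.
rewrite /saddle_field opp_col_mx add_col_mx opp_col_mx add_col_mx dot_col_mx.
rewrite -mulmxBr (dot_mulmx A^T) trmxK dotC mulmxBr -dotDr; congr dot.
by apply/colP => i; rewrite !mxE; ring.
Qed.

Lemma ncs_step_metric (M : 'M[R]_n) b (x x' : 'cV[R]_n) (u u' y : 'cV[R]_m) :
  M *m (x - x') = A^T *m u ->
  alpha *: y = u + alpha *: (A *m (2 *: x' - x) - b) - u' ->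
  ncs_metric M *m (col_mx x u - col_mx x' u') = alpha *: saddle_field b x' u' y.
Proof.
move=> Mstep ystep; rewrite opp_col_mx add_col_mx mul_block_col mul1mx.
rewrite /saddle_field scale_col_mx !mulNmx -!scalemxAl Mstep; congr col_mx.
  by rewrite mulmxBr scalerBr opprB addrC subrK.
rewrite [RHS]scalerBr ystep -[LHS]addrC !mulmxBr -scalemxAr.
by apply/colP => i; rewrite !mxE; ring.
Qed.

End NearCirculant.

(** * The rate of convergence *)

Theorem theorem3p2 (R : realType) (m n : nat)
    (A : 'M[R]_(m, n)) (b : 'cV[R]_m) (alpha : R) (alpha_gt0 : 0 < alpha)
    (g : 'cV[R]_m -> R) (g_convex : convex_function setT g)
    (prox_wd : prox_well_defined alpha (conjugate g))
    (M : 'M[R]_n) (M_sym : M \is symmetricmx)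
    (M_ge : psdmx (M - alpha *: (A^T *m A)))
    (primal_ex : exists x, primal_solution A b g x)
    (dual_ex : exists u, dual_solution A b g u)
    (duality : strong_duality A b g)
    (L : R) (g_lip : forall y z, `|g y - g z| <= L * enorm (y - z))
    (x0 : 'cV[R]_n) (u0 : 'cV[R]_m)
    (x : nat -> 'cV[R]_n) (u : nat -> 'cV[R]_m)
    (x_init : x 0%N = x0) (u_init : u 0%N = u0)
    (x_step : forall k, x k.+1 = x k - moore_penrose M *m A^T *m u k)
    (u_step : forall k, u k.+1 =
       prox alpha (conjugate g)
         (u k + alpha *: (A *m (2 *: x k.+1 - x k) - b)))
    (xs : 'cV[R]_n) (xs_sol : primal_solution A b g xs)
    (us : 'cV[R]_m) (us_sol : dual_solution A b g us) (k : nat) :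
  g (A *m x k.+1 - b) - g (A *m xs - b) <=
    1 / (alpha * Num.sqrt k.+1%:R) *
    (enorm (u0 - us - alpha *: (A *m (x0 - xs))) + enorm us + L +
     seminorm (alpha *: M - alpha ^+ 2 *: (A^T *m A)) (x0 - xs)) ^+ 2.
Proof.
have alpha_neq0 := lt0r_neq0 alpha_gt0.
have [us_feas _] := us_sol; rewrite /= in us_feas.
have us_sub := dual_solution_subgradient duality xs_sol us_sol.
have sqrtk_gt0 : 0 < Num.sqrt k.+1%:R :> R by rewrite sqrtr_gt0 ltr0n.
(* a negative L is possible only for m = 0, and then g is constant *)
have [L_lt0|L_ge0] := ltP L 0.
  rewrite (lipschitz_neg_const _ (A *m xs - b) g_lip L_lt0) subrr.
  by rewrite mulr_ge0 ?sqr_ge0 // divr_ge0 // mulr_ge0 // ltW.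
pose y j := alpha^-1 *:
  (u j + alpha *: (A *m (2 *: x j.+1 - x j) - b) - u j.+1).
have y_sub j : is_subgradient g (y j) (u j.+1).
  rewrite /y u_step.
  exact: prox_conjugate_subgradient alpha_gt0 g_convex g_lip prox_wd.
pose z j := col_mx (x j) (u j); pose zs := col_mx xs us.
pose T j := saddle_field A b (x j.+1) (u j.+1) (y j).
pose P := ncs_metric A alpha M.
have Ppsd : psdmx P by exact: ncs_metric_psd.
have step j : P *m (z j - z j.+1) = alpha *: T j.
  apply: ncs_step_metric.
    rewrite x_step opprB addrCA subrr addr0 !mulmxA.
    by rewrite (moore_penrose_trmx alpha_gt0).
  by rewrite /y scalerA mulfV // scale1r.
have T_monotone i j : 0 <= dot (z i.+1 - z j.+1) (alpha *: T i - alpha *: T j).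
  rewrite -scalerBr dotZr pmulr_rge0 // dot_saddle_field.
  exact: subgradient_monotone.
have T_zs : saddle_field A b xs us (A *m xs - b) = 0.
  by rewrite /saddle_field us_feas subrr col_mx0.
have dotT j : dot (z j.+1 - zs) (T j) = dot (u j.+1 - us) (y j - (A *m xs - b)).
  by rewrite -[T j]subr0 -T_zs dot_saddle_field.
have zs_zero j : 0 <= dot (z j.+1 - zs) (alpha *: T j).
  rewrite dotZr pmulr_rge0 // dotT; exact: subgradient_monotone.
have rate := proximal_point_rate Ppsd step T_monotone zs_zero k.
have e_le := proximal_point_dist Ppsd step zs_zero k.+1.
set d := z k - z k.+1 in rate; set e := z k.+1 - zs in e_le.
set D := seminorm P (z 0%N - zs) in rate e_le.
have d_le : seminorm P d * Num.sqrt k.+1%:R <= D.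
  rewrite -ler_sqr ?nnegrE ?mulr_ge0 ?seminorm_ge0 ?sqrtr_ge0 //.
  by rewrite exprMn (sqr_sqrtr (ler0n R k.+1)) mulrC.
have Q_ge0 v : 0 <= dot v ((alpha *: M - alpha ^+ 2 *: (A^T *m A)) *m v).
  exact: ncs_gram_ge0.
have D_le : D <= enorm (u0 - us - alpha *: (A *m (x0 - xs))) +
    seminorm (alpha *: M - alpha ^+ 2 *: (A^T *m A)) (x0 - xs).
  rewrite -ler_sqr ?nnegrE ?addr_ge0 ?seminorm_ge0 ?enorm_ge0 //.
  rewrite sqrrD sqr_seminorm // /z /zs x_init u_init opp_col_mx add_col_mx.
  rewrite ncs_metric_quad /seminorm (sqr_sqrtr (Q_ge0 _)) lerD2r lerDl.
  by rewrite mulrn_wge0 // mulr_ge0 ?enorm_ge0 ?sqrtr_ge0.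
pose w := u k - u k.+1 - alpha *: (A *m (x k - x k.+1)).
have w_le : enorm w <= seminorm P d.
  rewrite -ler_sqr ?nnegrE ?seminorm_ge0 ?enorm_ge0 // sqr_seminorm //.
  rewrite /d /z opp_col_mx add_col_mx ncs_metric_quad lerDl.
  exact: Q_ge0.
have wE : y k - (A *m x k.+1 - b) = alpha^-1 *: w.
  apply/colP => i; rewrite /y /w !mulmxBr -scalemxAr !mxE; field.
  exact: alpha_neq0.
have lip_part : alpha * (g (A *m x k.+1 - b) - g (y k)) <= L * enorm w.
  rewrite -ler_pdivlMl // mulrCA -[alpha^-1]gtr0_norm ?invr_gt0 // -enormZ.
  by rewrite -wE enorm_distC (le_trans (ler_norm _)).
have gap_part : alpha * (g (y k) - g (A *m xs - b)) <=
    seminorm P e * seminorm P d + enorm us * enorm w.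
  have sub_le : g (y k) - g (A *m xs - b) <=
      dot (u k.+1) (y k - (A *m xs - b)).
    by have := y_sub k (A *m xs - b); rewrite !dotE; lra.
  (* the component of y_k - y* in the range of A is orthogonal to us *)
  have us_part : alpha * dot us (y k - (A *m xs - b)) = dot us w.
    have -> : y k - (A *m xs - b) = alpha^-1 *: w + A *m (x k.+1 - xs).
      by rewrite -wE mulmxBr; apply/colP => i; rewrite !mxE; ring.
    rewrite dotDr dot_mulmx us_feas /dot trmx0 mul0mx [X in _ + X]mxE addr0.
    by rewrite -/(dot us _) dotZr mulrA mulfV // mul1r.
  have e_part :
      alpha * dot (u k.+1 - us) (y k - (A *m xs - b)) = dot e (P *m d).
    by rewrite step dotZr dotT.
  have : alpha * (g (y k) - g (A *m xs - b)) <= dot e (P *m d) + dot us w.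
    by rewrite -e_part -us_part -mulrDr -dotDl subrK ler_pM2l.
  by move=> /le_trans; apply; rewrite lerD ?dot_le_seminorm ?dot_le_enorm.
set a := enorm (u0 - _ - _) in D_le *.
set s := seminorm _ (x0 - xs) in D_le *.
rewrite mul1r ler_pdivlMl ?mulr_gt0 //.
have d_ge0 : 0 <= seminorm P d by exact: seminorm_ge0.
have us_ge0 := enorm_ge0 us.
have gap_le : alpha * (g (A *m x k.+1 - b) - g (A *m xs - b)) <=
    seminorm P d * (D + enorm us + L).
  have := ler_wpM2l L_ge0 w_le; have := ler_wpM2l us_ge0 w_le.
  have := ler_wpM2r d_ge0 e_le; lra.
have D_ge0 : 0 <= D by exact: seminorm_ge0.
have a_ge0 : 0 <= a by exact: enorm_ge0.
have s_ge0 : 0 <= s by exact: seminorm_ge0.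
rewrite mulrAC; apply: le_trans (ler_wpM2r (ltW sqrtk_gt0) gap_le) _.
rewrite mulrAC expr2.
apply: ler_pM; lra || by rewrite mulr_ge0 ?(ltW sqrtk_gt0).
Qed.
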